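(* Let $N\geq 2$ and $n\geq 2$ be integers. A tame semiregular frieze $\mathbf{F}$ of width $n$ over $\mathbb{Z}/N\mathbb{Z}$ lifts to a tame frieze over $\mathbb{Z}$ of the same width if and only if any path $\gamma$ in $\mathscr{F}_N$ corresponding to $\mathbf{F}$ is a strongly contractible closed path.
   Context: A frieze of width $n$ over a commutative ring $R$ with identity is a function $\mathbf{F}\colon\{(i,j)\in\mathbb{Z}^2:0\leq i-j\leq n\}\to R$, $m_{i,j}=\mathbf{F}(i,j)$, with $m_{i,i}=m_{n+i,i}=0$ for all $i\in\mathbb{Z}$ and $m_{i,j}m_{i+1,j+1}-m_{i,j+1}m_{i+1,j}=1$ for $0<i-j<n$. It is tame if the 3-by-3 matrix with rows $i-1,i,i+1$ and columns $j-1,j,j+1$ of entries of $\mathbf{F}$ has determinant $0$ whenever $1<i-j<n-1$. It is semiregular if $m_{i+1,i}=1$ for all $i\in\mathbb{Z}$. A frieze $\widetilde{\mathbf{F}}$ over $\mathbb{Z}$ of width $n$ is a lift of $\mathbf{F}$ (and $\mathbf{F}$ lifts to $\widetilde{\mathbf F}$) if reducing each entry of $\widetilde{\mathbf{F}}$ modulo $N$ gives $\mathbf{F}$. Let $R=\mathbb{Z}/N\mathbb{Z}$. A pair $(a,b)\in R\times R$ is unimodular if $aR+bR=R$. $\mathscr{E}_R$ is the directed graph whose vertices are the unimodular pairs, with a directed edge $(a,b)\to(c,d)$ if and only if $ad-bc=1$. The Farey complex $\mathscr{F}_N$ is the (undirected) graph whose vertices are the classes $\pm(a,b)=\{(a,b),(-a,-b)\}$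 of unimodular pairs in $R\times R$, with $\pm(a,b)$ and $\pm(c,d)$ adjacent if $ad-bc\in\{1,-1\}$. Its faces are the triples of mutually adjacent vertices. A path of length $n$ is a sequence of vertices $\langle v_0,\dots,v_n\rangle$ with consecutive vertices adjacent; it is closed if $v_n=v_0$. Corresponding paths: let $\gamma=\langle v_0,\dots,v_n\rangle$ be a path of length $n$ in $\mathscr{F}_N$ whose initial and final vertices are equivalent, meaning $v_n=\lambda v_0$ for some $\lambda\in R^\times$. Choose a path $\langle(a_0,b_0),\dots,(a_n,b_n)\rangle$ in $\mathscr{E}_R$ with $v_i=\pm(a_i,b_i)$; then $(a_n,b_n)=\lambda'(a_0,b_0)$ for some $\lambda'\in R^\times$; extend it to a bi-infinite path by $(a_{i+n},b_{i+n})=\lambda'^{(-1)^i}(a_i,b_i)$ for $i\in\mathbb{Z}$. The entries $m_{i,j}=a_jb_i-b_ja_i$, $0\leq i-j\leq n$, define a tame semiregular frieze of width $n$ over $R$ that does not depend on the choice of lift. The path $\gamma$ is said to correspond to $\mathbf{F}$ if this frieze is $\mathbf{F}$. A closed path in $\mathscr{F}_N$ is strongly contractible if it can be transformed to a point (a path of length $0$) by applying a finite number of the following two elementary homotopies: (E1) replace a subpath $\langle v,u,v\rangle$ with the subpath $\langle v\rangle$; (E2) replace a subpath $\langle u,v,w\rangle$ with $\langle u,w\rangle$, where $u,v,w$ are mutually adjacent vertices. (The inverse moves are not allowed.) *)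

(* Defs.v *)
From HB Require Import structures.
From mathcomp Require Import all_boot all_order all_algebra.

Set Implicit Arguments.
Unset Strict Implicit.
Unset Printing Implicit Defensive.

Import Order.TTheory GRing.Theory Num.Theory.
Local Open Scope ring_scope.

(* A function on {(i, j) in Z^2 : 0 <= i - j <= n} is encoded as a total      *)
(* function on Z^2; every condition below only inspects entries in that       *)
(* strip, so the values outside it are irrelevant.                            *)
Definition in_strip (n : nat) (i j : int) : bool := 0 <= i - j <= n%:Z.

Section Friezes.
Variables (R : comPzRingType) (n : nat).
Implicit Types F : int -> int -> R.

Definition frieze F : Prop :=
  [/\ forall i, F i i = 0,
      forall i, F (n%:Z + i) i = 0
    & forall i j, 0 < i - j < n%:Z ->
        F i j * F (i + 1) (j + 1) - F i (j + 1) * F (i + 1) j = 1].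

Definition tame F : Prop :=
  forall i j, 1 < i - j < n%:Z - 1 ->
    \det (\matrix_(r < 3, c < 3) F (i - 1 + r%:Z) (j - 1 + c%:Z)) = 0.

Definition semiregular F : Prop := forall i, F (i + 1) i = 1.

End Friezes.

(* Here 1 < N is assumed wherever 'Z_N is meant to be Z/NZ. *)
Definition lift_of (N n : nat) (F : int -> int -> 'Z_N)
    (Ft : int -> int -> int) : Prop :=
  forall i j, in_strip n i j -> (Ft i j)%:~R = F i j.

Section Farey.
Variable N : nat.
Local Notation R := 'Z_N.
Implicit Types p q : R * R.

Definition unimodular p : bool :=
  [forall c : R, exists x : R, exists y : R, c == p.1 * x + p.2 * y].

Definition det2 p q : R := p.1 * q.2 - p.2 * q.1.

(* Adjacency in the directed graph E_R. *)
Definition E_edge p q : bool :=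
  [&& unimodular p, unimodular q & det2 p q == 1].

Definition scale_pair (lam : R) p : R * R := (lam * p.1, lam * p.2).

Definition pm_class p : {set R * R} := [set p; scale_pair (-1) p].

Definition is_farey_vertex (v : {set R * R}) : bool :=
  [exists p, unimodular p && (v == pm_class p)].

Definition farey_vertex : Type := {v : {set R * R} | is_farey_vertex v}.
HB.instance Definition _ := SubFinite.on farey_vertex.
Implicit Types u v w : farey_vertex.

Definition farey_adj v w : bool :=
  [exists p in val v, exists q in val w, (det2 p q == 1) || (det2 p q == -1)].

(* As in path.v, the path <v_0, ..., v_n> is given by its initial vertex v_0  *)
(* and the sequence [:: v_1; ...; v_n].                                       *)
Definition equivalent_ends v0 (s : seq farey_vertex) : Prop :=
  exists2 lam : R, lam \is a GRing.unit &
    val (last v0 s) = [set scale_pair lam p | p in val v0].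

(* p is the bi-infinite extension of a path in E_R that lifts <v_0, ..., v_n>. *)
Definition lifted_path (n : nat) v0 (s : seq farey_vertex)
    (p : int -> R * R) : Prop :=
  [/\ forall i : nat, (i <= n)%N -> p i%:Z \in val (nth v0 (v0 :: s) i),
      forall i : nat, (i < n)%N -> E_edge (p i%:Z) (p i.+1%:Z)
    & exists2 lam : R, lam \is a GRing.unit &
        forall i : int,
          p (i + n%:Z) = scale_pair (lam ^ ((-1 : int) ^ i)) (p i)].

(* The frieze obtained does not depend on the lift p, hence the existential.  *)
Definition corresponds (n : nat) v0 (s : seq farey_vertex)
    (F : int -> int -> R) : Prop :=
  [/\ size s = n, path farey_adj v0 s, equivalent_ends v0 s
    & exists2 p, lifted_path n v0 s p &
        forall i j, in_strip n i j -> F i j = det2 (p j) (p i)].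

Definition closed_path v0 (s : seq farey_vertex) : Prop := last v0 s = v0.

Inductive elementary_homotopy : seq farey_vertex -> seq farey_vertex -> Prop :=
| homotopy_E1 s1 s2 v u :
    elementary_homotopy (s1 ++ [:: v; u; v] ++ s2) (s1 ++ [:: v] ++ s2)
| homotopy_E2 s1 s2 u v w :
    farey_adj u v -> farey_adj v w -> farey_adj u w ->
    elementary_homotopy (s1 ++ [:: u; v; w] ++ s2) (s1 ++ [:: u; w] ++ s2).

Inductive strongly_contractible : seq farey_vertex -> Prop :=
| contractible_point v : strongly_contractible [:: v]
| contractible_step s t :
    elementary_homotopy s t -> strongly_contractible t ->
    strongly_contractible s.

End Farey.

(* Main.v *)
Require Import Defs.
From HB Require Import structures.
From mathcomp Require Import all_boot all_order all_algebra.
From mathcomp Require Import zify ring.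

Set Implicit Arguments.
Unset Strict Implicit.
Unset Printing Implicit Defensive.

Import Order.TTheory GRing.Theory Num.Theory.
Local Open Scope ring_scope.

(** A path corresponding to [F] consists of vertices [v_0, ..., v_n] with
    representatives [p_0, ..., p_n] in pairs over [Z/N], where consecutive
    pairs have determinant [1]; so [(p_0, p_1)] is a frame and every pair over
    [Z/N] is an integer combination of it. The whole argument compares the path
    with integer sequences [P_0 = (1, 0), P_1, ..., P_n] of coordinate vectors
    in that frame, with consecutive determinants [1] or [-1] and
    [P_n = P_0] up to sign: closed paths in the Farey graph of the integers
    that reduce to the given path.

    Suppose that [F] lifts to an integer frieze. By the solution formula
    [p_i = m_(i,0) p_1 - m_(i,1) p_0], the vectors [(- m_(i,1), m_(i,0))] made of
    two columns of the lift form such an integer path: their consecutive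
    determinants are given by the frieze rule, and the bottom row of zeros makes
    the path close up. A closed integer path can always be shortened
    ([integral_path_contractible]): if every determinant of [P_(i-1)] with
    [P_(i+1)] were at least [2] in absolute value, then the absolute value of the
    determinant of [P_0] with [P_i] would increase strictly with [i]
    ([height_growth]) and the path could not return. A determinant [0] is a
    backtracking, hence a move (E1), and a determinant [1] or [-1] is a triangle,
    hence a move (E2). Reduced modulo [N], these moves contract the given path.

    Conversely, every move of a strong contraction can be undone over the
    integers ([contractible_integral_path]): a backtracking to a neighbour [u]
    lifts because a primitive vector completes to a basis
    ([neighbour_lift]), and a triangle lifts because its third
    vertex has coordinates [1] or [-1] in the basis formed by the
    other two ([triangle_lift]). So a strongly contractible
    path reduces from a closed integer path. Its signs can be fixed so that all
    consecutive determinants are [1] and the reductions are exactly the [p_i];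
    continued periodically up to sign, it defines an integer frieze by
    [m_(i,j) = det (P_j, P_i)].

    For this converse, some corresponding path must exist. Tameness
    turns the entries of [F] into solutions of a second-order linear recurrence
    ([frieze_row_recurrence]), and two independent solutions of it
    form the required sequence of pairs ([tame_frieze_cross]). *)

(** * Signs, integers and sequences *)

Definition pm1 (R : pzRingType) (x : R) : bool := (x == 1) || (x == -1).

Lemma pm1P (R : pzRingType) (x : R) : reflect (x = 1 \/ x = -1) (pm1 x).
Proof. by apply: (iffP orP) => -[]/eqP; [left|right|left|right]. Qed.

Lemma pm1N (R : pzRingType) (x : R) : pm1 (- x) = pm1 x.
Proof. by rewrite /pm1 eqr_oppLR orbC eqr_opp. Qed.

Lemma pm1_intr (R : pzRingType) (x : int) : pm1 x -> pm1 (x%:~R : R).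
Proof. by case/pm1P=> ->; apply/pm1P; [left|right; rewrite rmorphN1]. Qed.

Lemma int_unitP (a b : int) : a * b = 1 -> pm1 a.
Proof. by rewrite mulrC => h; have := intUnitRing.unitzPl h. Qed.

Lemma intr_Zp_surj (N : nat) (x : 'Z_N) : exists k : int, k%:~R = x.
Proof. by exists (Posz x); rewrite -[RHS]natr_Zp. Qed.

Lemma int_shift_ind (P : int -> Prop) :
  P 0 -> (forall i, P i -> P (i + 1)) -> (forall i, P (i + 1) -> P i) ->
  forall i, P i.
Proof.
move=> P0 up dn; elim/int_ind=> // k Pk.
  by rewrite -addn1 PoszD; apply: up.
by apply: dn; rewrite (_ : _ + 1 = - k%:Z) //; lia.
Qed.

Lemma int_divn_eq (n : nat) (i : int) : (0 < n)%N ->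
  exists q r, (r < n)%N /\ i = q * n%:Z + r%:Z.
Proof.
move=> n_gt0.
exists (i %/ n%:Z)%Z, `|(i %% n%:Z)%Z|%N.
have n0 : n%:Z != 0 by lia.
have h0 := modz_ge0 i n0.
have h1 : (i %% n%:Z)%Z < n%:Z by rewrite ltz_pmod //; lia.
by rewrite gez0_abs // -divz_eq; split=> //; lia.
Qed.

(** The form in which paths are cut around the segment that an elementary
    homotopy rewrites. *)
Lemma sorted_cut (T : Type) (r : rel T) (s1 s2 : seq T) (x : T) (m : seq T) :
  sorted r (s1 ++ (x :: m) ++ s2) =
  [&& sorted r (rcons s1 x), path r x m & path r (last x m) s2].
Proof. by rewrite /= sorted_cat_cons cat_path. Qed.

Lemma map_eq_cat (A B : Type) (g : A -> B) Z s1 s2 : map g Z = s1 ++ s2 ->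
  exists Z1 Z2, [/\ Z = Z1 ++ Z2, map g Z1 = s1 & map g Z2 = s2].
Proof.
move=> E; exists (take (size s1) Z), (drop (size s1) Z).
by rewrite cat_take_drop map_take map_drop E take_size_cat ?drop_size_cat.
Qed.

(** * The cross product of pairs *)

Definition cross (R : comPzRingType) (x y : R * R) : R :=
  x.1 * y.2 - x.2 * y.1.

Lemma crossC (R : comPzRingType) (x y : R * R) : cross y x = - cross x y.
Proof. rewrite /cross; ring. Qed.

Lemma cross_scale (R : comPzRingType) (a b : R) (x y : R * R) :
  cross (a * x.1, a * x.2) (b * y.1, b * y.2) = a * b * cross x y.
Proof. rewrite /cross /=; ring. Qed.

(** The Pluecker relation: it yields the frieze rule for any frieze whose
    entries are determinants of pairs. *)
Lemma plucker (R : comPzRingType) (a b c d : R * R) :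
  cross a c * cross b d - cross b c * cross a d = cross a b * cross c d.
Proof. rewrite /cross; ring. Qed.

Lemma cross_frame (R : comPzRingType) (e f x : R * R) : cross e f = 1 ->
  x = (cross x f * e.1 + cross e x * f.1, cross x f * e.2 + cross e x * f.2).
Proof.
move=> ef; rewrite [LHS]surjective_pairing; congr pair.
  by rewrite -[LHS]mulr1 -ef /cross; ring.
by rewrite -[LHS]mulr1 -ef /cross; ring.
Qed.

Lemma det3 (R : comPzRingType) (G : nat -> nat -> R) :
  \det (\matrix_(r < 3, c < 3) G r c) =
    G 0%N 0%N * (G 1%N 1%N * G 2%N 2%N - G 1%N 2%N * G 2%N 1%N)
  - G 0%N 1%N * (G 1%N 0%N * G 2%N 2%N - G 1%N 2%N * G 2%N 0%N)
  + G 0%N 2%N * (G 1%N 0%N * G 2%N 1%N - G 1%N 1%N * G 2%N 0%N).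
Proof.
rewrite (expand_det_row _ ord0) !big_ord_recl big_ord0 /cofactor.
rewrite !(expand_det_row _ ord0) !big_ord_recl !big_ord0 /cofactor.
rewrite !det_mx11 !mxE /= /bump /= ?addn0 ?add0n ?expr0 ?expr1 ?addnn /=.
ring.
Qed.

(** A linear relation between the rows that holds in two columns with
    nonsingular minor extends to the third column when the determinant
    vanishes. *)
Lemma det_extrapolate (R : comPzRingType) (a0 a1 a2 b0 b1 b2 c0 c1 c2 t : R) :
    c1 + a1 = t * b1 -> c2 + a2 = t * b2 -> a1 * b2 - a2 * b1 = 1 ->
    a0 * (b1 * c2 - b2 * c1) - a1 * (b0 * c2 - b2 * c0)
      + a2 * (b0 * c1 - b1 * c0) = 0 ->
  c0 + a0 = t * b0.
Proof.
move=> h1 h2 hm hd; apply/eqP; rewrite -subr_eq0 -[X in X == _]mulr1 -hm -hd.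
have -> : c1 = t * b1 - a1 by rewrite -h1; ring.
have -> : c2 = t * b2 - a2 by rewrite -h2; ring.
by apply/eqP; ring.
Qed.

Definition zadj (P Q : int * int) : bool := pm1 (cross P Q).

Lemma zadjC : symmetric zadj.
Proof. by move=> P Q; rewrite /zadj crossC pm1N. Qed.

(** Up to signs, [c] is the combination of [b] and [a] with coefficients
    [cross a c] and [1]. As in a continued fraction, a coefficient of
    absolute value at least [2] makes the heights [cross o _] grow. *)
Lemma height_growth (o a b c : int * int) :
    zadj a b -> zadj b c -> 1 < `|cross a c| ->
  `|cross o a| < `|cross o b| -> `|cross o b| < `|cross o c|.
Proof.
move=> /pm1P ab /pm1P bc ac hab.
have E : cross a b * cross o c = cross a c * cross o b - cross b c * cross o a.
  by rewrite /cross; ring.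
have L : `|cross a c * cross o b| >= 2 * `|cross o b| by rewrite normrM ler_wpM2r.
move: E L hab; set u := cross a c * cross o b.
by case: ab => ->; case: bc => ->; lia.
Qed.

(** Up to signs, [c - a] or [c + a] is the multiple of [b] with coefficient
    [cross a c]. *)
Lemma zadj_fold (a b c : int * int) :
    zadj a b -> zadj b c -> cross a c = 0 ->
  exists2 e : int, pm1 e & c = (e * a.1, e * a.2).
Proof.
(* cross b c * a + cross c a * b + cross a b * c = 0 holds for all pairs. *)
move=> ab bc ac; exists (- (cross a b * cross b c)).
  by case/pm1P: ab => ->; case/pm1P: bc => ->.
have ab2 : cross a b * cross a b = 1 by case/pm1P: ab => ->.
have E x y : cross a b * x = - (cross b c * y) ->
             x = - (cross a b * cross b c) * y.
  by move=> h; rewrite -[LHS]mul1r -ab2 -mulrA h; ring.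
rewrite [LHS]surjective_pairing; congr pair; apply: E.
  apply/eqP; rewrite -subr_eq0 -[0](mulr0 b.1) -ac; apply/eqP.
  by rewrite /cross; ring.
apply/eqP; rewrite -subr_eq0 -[0](mulr0 b.2) -ac; apply/eqP.
by rewrite /cross; ring.
Qed.

(** * Vertices of the Farey complex and their integer representatives *)

Section Vertices.
Variable N : nat.
Implicit Types (v w : farey_vertex N) (p q : 'Z_N * 'Z_N).
Local Notation scale_pair := (@Defs.scale_pair N).
Local Notation pm_class := (@pm_class N).
Local Notation unimodular := (@unimodular N).

Lemma mem_pm_class p q :
  q \in pm_class p -> exists2 e : 'Z_N, pm1 e & q = scale_pair e p.
Proof.
rewrite !inE => /orP[]/eqP->; [exists 1|exists (-1)] => //.
- by rewrite /Defs.scale_pair !mul1r; case: p.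
- by apply/pm1P; right.
Qed.

Lemma pm_class_scale (e : 'Z_N) p : pm1 e ->
  pm_class (scale_pair e p) = pm_class p.
Proof.
case: p => a b; case/pm1P=> ->; rewrite /pm_class /Defs.scale_pair /=.
  by rewrite !mul1r.
by rewrite !mulN1r !opprK setUC.
Qed.

Lemma pm_class_id p : p \in pm_class p.
Proof. by rewrite !inE eqxx. Qed.

(** Because of this, vertices can be compared, and adjacency tested, on
    arbitrary representatives. *)
Lemma vertex_val v p : p \in val v -> val v = pm_class p.
Proof.
case: v => /= x /existsP[q /andP[_ /eqP->]] /mem_pm_class[e e1 ->].
by rewrite pm_class_scale.
Qed.

Lemma vertex_eq v w p (e : 'Z_N) :
  p \in val v -> scale_pair e p \in val w -> pm1 e -> v = w.
Proof.
move=> /vertex_val pv /vertex_val pw e1; apply: val_inj.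
by rewrite pv pw pm_class_scale.
Qed.

Lemma farey_adjE v w p q :
  p \in val v -> q \in val w -> farey_adj v w = pm1 (cross p q).
Proof.
move=> pv qw; apply/existsP/idP; last first.
  by move=> h; exists p; rewrite pv; apply/existsP; exists q; rewrite qw.
case=> p' /andP[p'v /existsP[q' /andP[q'w h]]].
rewrite (vertex_val p'v) in pv; rewrite (vertex_val q'w) in qw.
have [a /pm1P a1 ->] := mem_pm_class pv; have [b /pm1P b1 ->] := mem_pm_class qw.
rewrite cross_scale.
by case: a1 => ->; case: b1 => ->;
  rewrite ?mulr1 ?mul1r ?mulrN1 ?opprK ?mulN1r ?mul1r ?pm1N.
Qed.

Lemma unimodular_cross p q : cross p q = 1 -> unimodular p.
Proof.
move=> h; apply/forallP => c; apply/existsP; exists (q.2 * c).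
apply/existsP; exists (- q.1 * c); apply/eqP.
by rewrite -[LHS]mul1r -h /cross; ring.
Qed.

End Vertices.

Section Frame.
Variables (N : nat) (e f : 'Z_N * 'Z_N).
Hypothesis ef : cross e f = 1.
Local Notation scale_pair := (@Defs.scale_pair N).
Local Notation labelled := ((int * int) * farey_vertex N)%type.
Implicit Types (P Q U W : int * int) (v w : farey_vertex N).

(** The reduction modulo [N] of an integer coordinate vector relative to the
    frame [(e, f)]. Working in the frame given by the first two pairs of a
    path makes every path start at [(1, 0)]. *)
Definition combine P : 'Z_N * 'Z_N :=
  (P.1%:~R * e.1 + P.2%:~R * f.1, P.1%:~R * e.2 + P.2%:~R * f.2).

Lemma cross_combine P Q : cross (combine P) (combine Q) = (cross P Q)%:~R.
Proof.
by rewrite -[RHS]mulr1 -[X in _ * X]ef /cross /combine /=; ring.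
Qed.

Lemma combine_scale (a : int) P :
  combine (a * P.1, a * P.2) = scale_pair a%:~R (combine P).
Proof. rewrite /combine /Defs.scale_pair /=; congr pair; ring. Qed.

(** The vectors of an integer path are stored together with the vertices to
    which they reduce, so that cutting and pasting acts on both sequences at
    once. *)
Definition lies_above (z : labelled) : bool := combine z.1 \in val z.2.

Lemma farey_adj_above (z w : labelled) : lies_above z -> lies_above w ->
  farey_adj z.2 w.2 = pm1 ((cross z.1 w.1)%:~R : 'Z_N).
Proof. by move=> hz hw; rewrite (farey_adjE hz hw) cross_combine. Qed.

Lemma same_vertex_above (z w : labelled) (a : int) :
    lies_above z -> lies_above w -> pm1 a ->
  w.1 = (a * z.1.1, a * z.1.2) -> z.2 = w.2.
Proof.
rewrite /lies_above => hz hw a1 wE; move: hw; rewrite wE combine_scale => hw.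
by apply: (vertex_eq hz hw); apply: pm1_intr.
Qed.

End Frame.

(** * Contracting closed integer paths *)

Section IntegerPaths.
Variable V : Type.
Local Notation labelled := ((int * int) * V)%type.

Definition ladj (z w : labelled) : bool := zadj z.1 w.1.

(** Otherwise the heights would increase strictly up to the end of the path,
    where the height is zero. *)
Lemma short_diagonal (o : int * int) (a b : labelled) (s : seq labelled) :
    path ladj a (b :: s) -> `|cross o a.1| < `|cross o b.1| ->
    cross o (last b s).1 = 0 ->
  exists s1 x y z s2,
    a :: b :: s = s1 ++ [:: x; y; z] ++ s2 /\ `|cross x.1 z.1| <= 1.
Proof.
elim: s a b => [|c s IHs] a b /=; first by move=> _ h h0; rewrite h0 in h; lia.
case/and3P=> ab bc cs hab h0.
have [ac|ac] := leP `|cross a.1 c.1| 1; first by exists [::], a, b, c, s.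
have hbc := height_growth ab bc ac hab.
have [|s1 [x [y [z [s2 [E xz]]]]]] := IHs b c _ hbc h0; first by rewrite /= bc.
by exists (a :: s1), x, y, z, s2; rewrite E.
Qed.

End IntegerPaths.

Section Contraction.
Variables (N : nat) (e f : 'Z_N * 'Z_N).
Hypothesis ef : cross e f = 1.
Local Notation labelled := ((int * int) * farey_vertex N)%type.
Local Notation above := (lies_above e f).

Definition integral_path (Z : seq labelled) : bool :=
  all above Z && sorted (@ladj _) Z.

(** Induction on the length: at a short diagonal, the path folds back or cuts
    off a triangle, and the corresponding move keeps both ends of the path up
    to sign. *)
Lemma integral_path_contractible (z : labelled) (s : seq labelled) :
    integral_path (z :: s) -> cross z.1 (last z s).1 = 0 ->
  strongly_contractible [seq w.2 | w <- z :: s].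
Proof.
have [m] := ubnP (size s); elim: m z s => // m IHm z [|b s] /= hs.
  by move=> _ _; apply: contractible_point.
move=> /andP[/= hall hsort] h0.
have hb : `|cross z.1 z.1| < `|cross z.1 b.1|.
  have -> : cross z.1 z.1 = 0 by rewrite /cross; ring.
  by case/andP: hsort => /pm1P[] ->.
have [s1 [x [y [t [s2 [E xt]]]]]] := short_diagonal hsort hb h0.
have {}hall : all above (s1 ++ [:: x; y; t] ++ s2) by rewrite -E.
have {}hsort : sorted (@ladj _) (s1 ++ [:: x; y; t] ++ s2) by rewrite -E.
have hlast : last z (s1 ++ [:: x; y; t] ++ s2) = last b s by rewrite -E.
have hhead : head z (s1 ++ [:: x; y; t] ++ s2) = z by rewrite -E.
have hsize : (size (s1 ++ [:: x; y; t] ++ s2) <= m.+1)%N by rewrite -E.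
have -> : [:: z.2, b.2 & [seq w.2 | w <- s]] =
          [seq w.2 | w <- s1 ++ [:: x; y; t] ++ s2] by rewrite -E.
move: hsort; rewrite sorted_cut => /and3P[hs1 /and3P[/= xy yt _] hs2].
move: hall; rewrite !all_cat /= => /and3P[as1 /and4P[ax ay a_t _] as2].
rewrite !map_cat.
have shrink Z : all above Z -> sorted (@ladj _) Z -> (size Z <= m)%N ->
    (0 < size Z)%N -> (head z Z).1 = z.1 -> cross z.1 (last z Z).1 = 0 ->
    strongly_contractible [seq w.2 | w <- Z].
  case: Z => // z' Z' hZ1 hZ2 hZ3 _ /= hZ4 hZ5; apply: IHm; first exact: hZ3.
    by apply/andP.
  by rewrite hZ4.
(* Determinant 0 gives a fold, removed by (E1); determinant 1 or -1 gives a
   triangle, cut by (E2). *)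
have [xt0|xt0] := eqVneq (cross x.1 t.1) 0.
  have [a a1 tE] := zadj_fold xy yt xt0.
  rewrite /= -(same_vertex_above ax a_t a1 tE).
  apply: contractible_step; first exact: homotopy_E1.
  move: (shrink (s1 ++ [:: x] ++ s2)); rewrite !map_cat; apply.
  - by rewrite !all_cat /= as1 ax.
  - rewrite sorted_cut hs1 /=; case: s2 hs2 {as2 hsize hlast hhead E} => //= c s2.
    case/andP=> tc ->; rewrite andbT; move: tc; rewrite /ladj /zadj tE.
    have -> : cross (a * x.1.1, a * x.1.2) c.1 = a * cross x.1 c.1.
      by rewrite /cross /=; ring.
    by case/pm1P: a1 => ->; rewrite ?mul1r ?mulN1r ?pm1N.
  - by move: hsize; rewrite !size_cat /=; clear; lia.
  - by rewrite !size_cat /=; clear; lia.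
  - by move: hhead; case: (s1) => [|c s1'] /= ->.
  - move: h0; rewrite -hlast !last_cat /=; case: (s2) => //= {hlast hhead}.
    rewrite tE => h.
    have {}h : a * cross z.1 x.1 = 0 by rewrite -h /cross /=; ring.
    by case/pm1P: a1 h => ->; rewrite ?mul1r // mulN1r => /eqP;
      rewrite oppr_eq0 => /eqP.
have xt1 : zadj x.1 t.1 by apply/pm1P; move: xt xt0; clear; lia.
apply: contractible_step.
  apply: homotopy_E2; rewrite (farey_adj_above ef) //; exact: pm1_intr.
move: (shrink (s1 ++ [:: x; t] ++ s2)); rewrite !map_cat; apply.
- by rewrite !all_cat /= as1 ax a_t.
- by rewrite sorted_cut hs1 /= /ladj xt1 hs2.
- by move: hsize; rewrite !size_cat /=; clear; lia.
- by rewrite !size_cat /=; clear; lia.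
- by move: hhead; case: (s1) => [|c s1'] /= ->.
- by move: h0; rewrite -hlast !last_cat.
Qed.

End Contraction.

(** * Friezes that lift have contractible paths *)

Section Necessity.
Variables (N : nat) (e f : 'Z_N * 'Z_N).
Hypothesis ef : cross e f = 1.
Local Notation labelled := ((int * int) * farey_vertex N)%type.
Local Notation above := (lies_above e f).

Lemma integral_walk_contractible (Q : nat -> int * int) v0 s :
    (forall i, (i <= size s)%N -> above (Q i, nth v0 (v0 :: s) i)) ->
    (forall i, (i < size s)%N -> zadj (Q i) (Q i.+1)) ->
    cross (Q 0%N) (Q (size s)) = 0 ->
  strongly_contractible (v0 :: s).
Proof.
move=> hab hadj h0.
pose z i : labelled := (Q i, nth v0 (v0 :: s) i).
have E : v0 :: s = [seq w.2 | w <- mkseq z (size s).+1].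
  by rewrite -map_comp -[LHS](mkseq_nth v0).
rewrite E.
have -> : mkseq z (size s).+1 = z 0%N :: map z (iota 1 (size s)) by [].
apply: (integral_path_contractible ef).
  have -> : z 0%N :: map z (iota 1 (size s)) = mkseq z (size s).+1 by [].
  apply/andP; split.
    rewrite /mkseq all_map; apply/allP => i; rewrite mem_iota => hi.
    by apply: hab; lia.
  apply/(sortedP (z 0%N)) => i; rewrite size_mkseq => hi.
  by rewrite !nth_mkseq //; [apply: hadj; lia | lia].
rewrite last_map (last_nth 0%N) size_iota.
by rewrite -[0%N :: _]/(iota 0 (size s).+1) nth_iota.
Qed.

End Necessity.

Section Lift.
Variables (N n : nat) (F : int -> int -> 'Z_N) (Ft : int -> int -> int).
Hypotheses (n_gt1 : (1 < n)%N) (FtF : lift_of n F Ft) (frFt : frieze n Ft).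

(** The coordinates of the [i]-th pair of a corresponding path in the frame
    of its first two pairs are [F i 0] and [- F i 1], which is how the lift
    provides integer coordinates. The value at [0] is set apart because the
    entry [F 0 1] lies outside the strip. *)
Definition lifted_column (i : nat) : int * int :=
  if i is 0%N then (1, 0) else (- Ft i 1, Ft i 0).

Lemma frieze_lift_contractible v0 s :
  corresponds n v0 s F -> closed_path v0 s /\ strongly_contractible (v0 :: s).
Proof.
have [Fd Fn F2] := frFt.
case=> ss _ _ [p [pv pE _] Fp].
have n0 : (0 < n)%N by lia.
have ef : cross (p 0) (p 1) = 1 by have /and3P[_ _ /eqP] := pE 0%N n0.
have Qp i : (i <= n)%N -> combine (p 0) (p 1) (lifted_column i) = p i.
  case: i => [|i] hi.
    by rewrite /combine /= !mul1r !mul0r !addr0; case: (p 0).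
  rewrite [RHS](cross_frame _ ef) /combine /= rmorphN /=.
  rewrite !FtF /in_strip; [|lia|lia].
  rewrite !Fp /in_strip; [|lia|lia].
  by rewrite -[Defs.det2 _ _]/(cross _ _) -[Defs.det2 (p 0) _]/(cross _ _) -crossC.
(* The entry at (n, 1) is a unit by the frieze rule next to the row of zeros,
   so the last vector is (1, 0) or (- 1, 0). *)
have Qn : cross (1, 0) (lifted_column n) = 0 /\ pm1 (lifted_column n).1.
  case: n n0 n_gt1 Fn F2 => // m _ m1 Fn F2; split.
    by rewrite /cross /= -[m.+1%:Z]addr0 Fn; ring.
  rewrite pm1N; apply: (int_unitP (b := Ft (m.+1%:Z + 1) (1 + 1))).
  rewrite -[RHS](F2 m.+1%:Z 1); last lia.
  by rewrite (Fn 1) mulr0 subr0.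
have habove i : (i <= n)%N ->
    lies_above (p 0) (p 1) (lifted_column i, nth v0 (v0 :: s) i).
  by move=> hi; rewrite /lies_above /= Qp //; apply: pv.
split.
  rewrite /closed_path (last_nth v0) ss.
  have := habove n (leqnn n); have := habove 0%N (leq0n n).
  case: Qn => + q1; rewrite /cross /= mul1r mul0r subr0 => q0 h0 hn.
  apply: esym; apply: (same_vertex_above h0 hn q1) => /=.
  by rewrite mulr1 mulr0 -q0; case: lifted_column.
apply: (integral_walk_contractible ef (Q := lifted_column)); rewrite ss //.
  case=> [|i] hi; rewrite /zadj /cross /=.
    rewrite mul1r mul0r subr0; apply: (int_unitP (b := Ft (1 + 1) (0 + 1))).
    by rewrite -[RHS](F2 1 0) ?(Fd 1) ?mul0r ?subr0 //; lia.
  apply/pm1P; left; rewrite -[RHS](F2 i.+1%:Z 0); last lia.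
  by rewrite add0r (_ : i.+2%:Z = i.+1%:Z + 1); [ring | lia].
by case: Qn.
Qed.

End Lift.

(** * Lifting a strong contraction to the integers *)

Section Lifting.
Variables (N : nat) (e f : 'Z_N * 'Z_N).
Hypothesis ef : cross e f = 1.
Local Notation labelled := ((int * int) * farey_vertex N)%type.
Local Notation above := (lies_above e f).
Local Notation combine := (combine e f).

Definition primitive (P : int * int) : bool := coprimez P.1 P.2.

Lemma primitiveP P : reflect (exists Q, cross P Q = 1) (primitive P).
Proof.
apply: (iffP (coprimezP _ _)) => [[[u v] /= h]|[Q h]].
  by exists (- v, u); rewrite -h /cross /=; ring.
by exists (Q.2, - Q.1); rewrite -h /cross /=; ring.
Qed.

Lemma zadj_primitive P Q : zadj P Q -> primitive P.
Proof.
move=> /pm1P h; apply/primitiveP.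
case: h => h; first by exists Q.
by exists (- Q.1, - Q.2); rewrite -[RHS]opprK -h /cross /=; ring.
Qed.

Lemma pm1_lift (x : 'Z_N) : pm1 x -> exists2 k : int, pm1 k & k%:~R = x.
Proof. by case/pm1P=> ->; [exists 1|exists (-1)]; rewrite ?rmorphN1. Qed.

(** The vector [z.1] completes to an integer basis. In its reduction, a
    representative of [u] has the second coordinate [1] or [-1], which is
    kept as an integer; the other coordinate may be lifted arbitrarily. *)
Lemma neighbour_lift (z : labelled) (u : farey_vertex N) :
    above z -> primitive z.1 -> farey_adj z.2 u ->
  exists U, above (U, u) /\ zadj z.1 U.
Proof.
move=> az /primitiveP[Q zQ]; have [q qu] : exists q, q \in val u.
  by case: u => /= x /existsP[q /andP[_ /eqP->]]; exists q; exact: pm_class_id.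
rewrite (farey_adjE az qu) => zq.
have fr : cross (combine z.1) (combine Q) = 1 by rewrite (cross_combine ef) zQ.
have [k k1 kE] := pm1_lift zq.
have [l lE] := intr_Zp_surj (cross q (combine Q)).
exists (l * z.1.1 + k * Q.1, l * z.1.2 + k * Q.2); split.
  rewrite /lies_above /= (_ : combine _ = q) // [RHS](cross_frame _ fr) -kE -lE.
  by rewrite /combine /=; congr pair; ring.
rewrite /zadj (_ : cross _ _ = k * cross z.1 Q); last by rewrite /cross /=; ring.
by rewrite zQ mulr1.
Qed.

(** In the frame given by [z] and [w], both coordinates of a representative
    of [v] are [1] or [-1], and keeping them as integers gives the wanted
    vector. *)
Lemma triangle_lift (z w : labelled) (v : farey_vertex N) :
    above z -> above w -> zadj z.1 w.1 -> farey_adj z.2 v -> farey_adj v w.2 ->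
  exists U, [/\ above (U, v), zadj z.1 U & zadj U w.1].
Proof.
move=> az aw zw; have [q qv] : exists q, q \in val v.
  by case: v => /= x /existsP[q /andP[_ /eqP->]]; exists q; exact: pm_class_id.
rewrite (farey_adjE az qv) (farey_adjE qv aw) => zq qw.
have [k k1 kE] := pm1_lift zq; have [l l1 lE] := pm1_lift qw.
(* The reductions of z.1 and w.1 have determinant d, so w.1 is rescaled by d
   to obtain a frame. *)
pose d := cross z.1 w.1; have dd : d * d = 1 by case/pm1P: zw; rewrite /d => ->.
have fr : cross (combine z.1)
                (d%:~R * (combine w.1).1, d%:~R * (combine w.1).2) = 1.
  transitivity (d%:~R * cross (combine z.1) (combine w.1)).
    by rewrite /cross /=; ring.
  by rewrite (cross_combine ef) -rmorphM /= dd.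
exists (d * (l * z.1.1 + k * w.1.1), d * (l * z.1.2 + k * w.1.2)); split.
- rewrite /lies_above /= (_ : combine _ = q) // [RHS](cross_frame _ fr).
  rewrite (_ : cross q _ = d%:~R * cross q (combine w.1)); last first.
    by rewrite /cross /=; ring.
  by rewrite -kE -lE /combine /=; congr pair; ring.
- rewrite /zadj (_ : cross _ _ = d * d * k); first by rewrite dd mul1r.
  by rewrite /d /cross /=; ring.
- rewrite /zadj (_ : cross _ _ = d * d * l); first by rewrite dd mul1r.
  by rewrite /d /cross /=; ring.
Qed.

(** Induction along the contraction, undoing one move at a time. Both moves
    preserve the first and the last vertex, so the integer path keeps its
    starting vector and its end stays proportional to it. Primitivity is
    carried along because a path of length zero has no neighbour from which
    to derive it. *)
Lemma contractible_integral_path (l : seq (farey_vertex N)) :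
    strongly_contractible l -> sorted (@farey_adj N) l ->
  forall d : labelled, above d -> primitive d.1 -> ohead l = Some d.2 ->
  exists Z, [/\ [seq w.2 | w <- Z] = l, integral_path e f Z,
     all (fun w => primitive w.1) Z, head d Z = d & cross d.1 (last d Z).1 = 0].
Proof.
elim=> [v _ d ad pd [->]|s t st _ IH ls d ad pd hd].
  exists [:: d]; split=> //=; first by rewrite /integral_path /= ad.
    by rewrite pd.
  by rewrite /cross; ring.
case: st IH ls hd => {s t}[s1 s2 v u|s1 s2 u v w uv vw uw] IH.
  rewrite sorted_cut /= => /and3P[ls1 /and3P[vu uv _] ls2] hd.
  have [||Z [EZ /andP[aZ sZ] pZ hZ lZ]] := IH _ d ad pd.
  - by rewrite sorted_cut ls1 ls2.
  - by rewrite -hd; case: (s1).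
  have [Z1 [Z' [EZ1 E1 E']]] := map_eq_cat EZ.
  case: Z' E' EZ1 => //= x Z2 [Ex E2] EZ1; subst Z v s1 s2 => {EZ IH}.
  move: aZ pZ sZ; rewrite !all_cat -[x :: Z2]/([:: x] ++ Z2) sorted_cut /=.
  move=> /and3P[aZ1 ax aZ2] /and3P[pZ1 px pZ2] /andP[sZ1 sZ2].
  have [U [aU xU]] := neighbour_lift ax px vu.
  exists (Z1 ++ [:: x; (U, u); x] ++ Z2); split.
  - by rewrite !map_cat.
  - apply/andP; rewrite !all_cat sorted_cut /= aZ1 ax aU aZ2 sZ1 sZ2.
    by rewrite /ladj /= xU zadjC xU.
  - rewrite !all_cat /= pZ1 px pZ2 (@zadj_primitive U x.1) // zadjC //.
  - by move: hZ; case: (Z1).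
  - by rewrite -lZ !last_cat.
rewrite sorted_cut /= => /and3P[ls1 _ ls2] hd.
have [||Z [EZ /andP[aZ sZ] pZ hZ lZ]] := IH _ d ad pd.
- by rewrite sorted_cut ls1 /= uw ls2.
- by rewrite -hd; case: (s1).
have [Z1 [Z' [EZ1 E1 E']]] := map_eq_cat EZ.
case: Z' E' EZ1 => //= x [|y Z2] //= [Ex Ey E2] EZ1; subst Z u w s1 s2 => {EZ IH}.
move: aZ pZ sZ; rewrite !all_cat -[x :: y :: Z2]/([:: x; y] ++ Z2) sorted_cut /=.
move=> /and4P[aZ1 ax ay aZ2] /and4P[pZ1 px py pZ2] /and3P[sZ1 /andP[xy _] sZ2].
have [U [aU xU Uy]] := triangle_lift ax ay xy uv vw.
exists (Z1 ++ [:: x; (U, v); y] ++ Z2); split.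
- by rewrite !map_cat.
- apply/andP; rewrite !all_cat sorted_cut /= aZ1 ax aU ay aZ2 sZ1 sZ2.
  by rewrite /ladj /= xU Uy.
- rewrite !all_cat /= pZ1 px py pZ2 (@zadj_primitive U y.1) //.
- by move: hZ; case: (Z1).
- by rewrite -lZ !last_cat.
Qed.

End Lifting.

(** * From an integer path to an integer frieze *)

Section Orientation.

(** For a path of [zadj], each factor is a sign, chosen so that consecutive
    determinants become [1]. *)
Fixpoint orient (P : nat -> int * int) (i : nat) : int * int :=
  if i is j.+1 then
    (cross (orient P j) (P i) * (P i).1, cross (orient P j) (P i) * (P i).2)
  else P 0%N.

Variables (N n : nat) (e f : 'Z_N * 'Z_N).
Hypothesis ef : cross e f = 1.
Variables (P : nat -> int * int) (p : nat -> 'Z_N * 'Z_N)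
          (v : nat -> farey_vertex N).
Hypotheses (P0 : combine e f (P 0%N) = p 0%N)
  (Padj : forall i, (i < n)%N -> zadj (P i) (P i.+1))
  (Pv : forall i, (i <= n)%N -> combine e f (P i) \in val (v i))
  (pv : forall i, (i <= n)%N -> p i \in val (v i))
  (pp : forall i, (i < n)%N -> cross (p i) (p i.+1) = 1).

Lemma orient_sign i : (i <= n)%N ->
  exists2 c, pm1 c & orient P i = (c * (P i).1, c * (P i).2).
Proof.
elim: i => [|i IH] hi /=; first by exists 1; rewrite ?mul1r //; case: (P 0%N).
have [c c1 ->] := IH (ltnW hi).
exists (cross (c * (P i).1, c * (P i).2) (P i.+1)) => //.
rewrite (_ : cross _ _ = c * cross (P i) (P i.+1)); last by rewrite /cross /=; ring.
by case/pm1P: c1 => ->; rewrite ?mul1r ?mulN1r ?pm1N; apply: Padj.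
Qed.

Lemma orient_cross i : (i < n)%N -> cross (orient P i) (orient P i.+1) = 1.
Proof.
move=> hi /=; have [c c1 ->] := orient_sign (ltnW hi).
have /pm1P := Padj hi; set a := cross (P i) (P i.+1) => ha.
rewrite (_ : cross _ _ = (c * a) * (c * a)); last by rewrite /a /cross /=; ring.
by case/pm1P: c1 => ->; case: ha => ->.
Qed.

(** A priori the reductions of the oriented vectors are the [p i] up to sign
    only. But both sequences have consecutive determinants [1], so once they
    agree at [i], the sign at [i.+1] equals [1] in [Z/N]. *)
Lemma combine_orient i : (i <= n)%N -> combine e f (orient P i) = p i.
Proof.
elim: i => [|i IH] hi; first exact: P0.
have [c c1 cE] := orient_sign hi.
have hQ : combine e f (orient P i.+1) \in val (v i.+1).
  rewrite cE combine_scale (vertex_val (Pv hi)) -(pm_class_scale _ (pm1_intr _ c1)).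
  exact: pm_class_id.
have := pv hi; rewrite (vertex_val hQ) => /mem_pm_class[a _ aE].
have := pp hi; rewrite -(IH (ltnW hi)) aE => h.
(* cross (p i) (p i.+1) is a times the determinant of the oriented vectors, and
   both determinants are 1. *)
have a1 : a = 1.
  rewrite -h; set Q := combine e f (orient P i.+1).
  rewrite (_ : cross _ _ = a * cross (combine e f (orient P i)) Q); last first.
    by rewrite /cross /=; ring.
  by rewrite (cross_combine ef) orient_cross // mulr1.
by rewrite a1 /Defs.scale_pair !mul1r; case: combine.
Qed.

End Orientation.

Section Periodic.
Variables (n : nat) (x : int) (Q : nat -> int * int).
Hypotheses (n_gt0 : (0 < n)%N) (x1 : pm1 x)
  (Qn : Q n = (x * (Q 0%N).1, x * (Q 0%N).2))
  (QQ : forall i, (i < n)%N -> cross (Q i) (Q i.+1) = 1).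

(** The integer path closes only up to the sign [x], so each period
    contributes one factor [x]. *)
Definition periodic (i : int) : int * int :=
  let a := x ^ (i %/ n%:Z)%Z in let P := Q `|(i %% n%:Z)%Z|%N in
  (a * P.1, a * P.2).

Lemma pm1_exprz q : pm1 (x ^ q).
Proof. exact: (unitrXz q (x1 : x \is a GRing.unit)). Qed.

Lemma exprzS q : x ^ (q + 1) = x ^ q * x.
Proof. exact: (exprzDr (x1 : x \is a GRing.unit) q 1). Qed.

(** Including [r = n], where consecutive blocks agree, keeps the indices [i]
    and [i + 1] within one block. *)
Lemma periodicE q r : (r <= n)%N ->
  periodic (q * n%:Z + r%:Z) = (x ^ q * (Q r).1, x ^ q * (Q r).2).
Proof.
have E t s : (s < n)%N ->
    periodic (t * n%:Z + s%:Z) = (x ^ t * (Q s).1, x ^ t * (Q s).2).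
  move=> hs; have n0 : n%:Z != 0 by lia.
  by rewrite /periodic divzMDl // modzMDl divz_small ?modz_small ?addr0 //; lia.
rewrite leq_eqVlt => /orP[/eqP->|/E//].
rewrite (_ : q * n%:Z + n%:Z = (q + 1) * n%:Z + 0%N%:Z); last by lia.
by rewrite E // exprzS Qn /= !mulrA.
Qed.

Lemma periodic_cross i : cross (periodic i) (periodic (i + 1)) = 1.
Proof.
have [q [r [hr ->]]] := int_divn_eq i n_gt0.
rewrite (_ : _ + _ + 1 = q * n%:Z + r.+1%:Z); last by lia.
rewrite (periodicE q (ltnW hr)) (periodicE q hr) cross_scale QQ //.
by case/pm1P: (pm1_exprz q) => ->.
Qed.

Lemma periodic_shift i :
  periodic (n%:Z + i) = (x * (periodic i).1, x * (periodic i).2).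
Proof.
have [q [r [hr ->]]] := int_divn_eq i n_gt0.
rewrite (_ : _ + (_ + _) = (q + 1) * n%:Z + r%:Z); last by lia.
rewrite !periodicE 1?ltnW // exprzS /=; congr pair; ring.
Qed.

End Periodic.

(** The frieze rule is the Pluecker relation, and tameness holds because a
    matrix of determinants of pairs factors through rank [2]. *)
Lemma cross_frieze (R : comPzRingType) (n : nat) (Q : int -> R * R) (x : R) :
    (forall i, cross (Q i) (Q (i + 1)) = 1) ->
    (forall i, Q (n%:Z + i) = (x * (Q i).1, x * (Q i).2)) ->
  frieze n (fun i j => cross (Q j) (Q i)) /\ tame n (fun i j => cross (Q j) (Q i)).
Proof.
move=> QQ Qn; split; first split.
- by move=> i; rewrite /cross; ring.
- by move=> i; rewrite Qn /cross /=; ring.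
- by move=> i j _; rewrite plucker !QQ mulr1.
move=> i j _.
rewrite (det3 (fun r c : nat => cross (Q (j - 1 + c%:Z)) (Q (i - 1 + r%:Z)))).
by rewrite /cross; ring.
Qed.

Section Sufficiency.
Variables (N n : nat) (F : int -> int -> 'Z_N).
Hypothesis n_gt0 : (0 < n)%N.

(** Since [p 0] is [combine e f (1, 0)], the end of the oriented integer path
    determines the multiplier [lam] of the path as the reduction of a sign
    [x]. Hence the powers of [lam] in the continuation of [p] all reduce to
    multiplication by [x], as in the periodic continuation of the integer
    path. *)
Lemma contractible_frieze_lifts v0 s :
    corresponds n v0 s F -> strongly_contractible (v0 :: s) ->
  exists Ft : int -> int -> int, [/\ frieze n Ft, tame n Ft & lift_of n F Ft].
Proof.
case=> ss vs _ [p [pv pE [lam _ lamE]] Fp] hc.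
have pp i : (i < n)%N -> cross (p i%:Z) (p i.+1%:Z) = 1.
  by move=> /pE/and3P[_ _ /eqP].
have ef : cross (p 0) (p 1) = 1 by exact: (pp 0%N).
set e := p 0 in ef *; set f := p 1 in ef *.
have c0 : combine e f (1, 0) = e.
  by rewrite /combine /= !mul1r !mul0r !addr0; case: (e).
have [|||Z [EZ /andP[aZ sZ] _ hZ lZ]] :=
  contractible_integral_path ef hc vs (d := ((1, 0), v0)) => //.
  by rewrite /lies_above /= c0; exact: (pv 0%N).
set d := ((1, 0), v0) in hZ lZ.
have sizeZ : size Z = n.+1 by rewrite -(size_map snd) EZ /= ss.
pose P i := (nth d Z i).1.
have Padj i : (i < n)%N -> zadj (P i) (P i.+1).
  by move=> hi; move/(sortedP d): sZ => /(_ i); rewrite sizeZ; apply.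
have Pv i : (i <= n)%N -> combine e f (P i) \in val (nth v0 (v0 :: s) i).
  move=> hi; rewrite -EZ (nth_map d) ?sizeZ //.
  by have /allP := aZ; apply; rewrite mem_nth ?sizeZ.
have P0 : P 0%N = (1, 0) by rewrite /P nth0 hZ.
have PQ := combine_orient ef (p := fun i : nat => p i%:Z) _ Padj Pv pv pp.
pose Q := orient P.
have {}PQ i : (i <= n)%N -> combine e f (Q i) = p i%:Z by apply: PQ; rewrite P0.
have QQ := @orient_cross n P Padj.
pose x := (Q n).1.
(* The path ends at (x, 0), and determinant 1 with the previous vector forces
   the integer x to be a unit. *)
have Qn2 : (Q n).2 = 0.
  have [c _ cE] := orient_sign Padj (leqnn n).
  move: lZ; rewrite -nth_last sizeZ -/(P n) /cross /= mul1r mul0r subr0 => lZ.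
  by rewrite /Q cE /= lZ mulr0.
have x1 : pm1 x.
  have := QQ n.-1; rewrite prednK // leqnn => /(_ isT).
  rewrite /cross Qn2 mulr0 sub0r -mulNr mulrC; exact: int_unitP.
have Qn : Q n = (x * (Q 0%N).1, x * (Q 0%N).2).
  by rewrite /Q /= P0 /= mulr1 mulr0 -Qn2 /x /Q; case: (orient P n).
have lx : lam = x%:~R.
  have := lamE 0; rewrite add0r -(PQ n (leqnn n)) Qn /Q /= P0 combine_scale c0.
  move/(congr1 (fun y => cross y f)).
  have Ec a : cross (Defs.scale_pair a e) f = a * cross e f.
    by rewrite /cross /=; ring.
  by rewrite !Ec ef !mulr1 expr0z expr1z.
have xx : (x%:~R : 'Z_N) * x%:~R = 1.
  by case/pm1P: x1 => ->; rewrite ?rmorphN1 ?mulrNN mulr1.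
(* The exponent of lam is 1 or -1, and x is its own inverse. *)
have pn i : p (i + n%:Z) = Defs.scale_pair x%:~R (p i).
  rewrite lamE lx; congr Defs.scale_pair.
  have hu : (x%:~R : 'Z_N)^-1 = x%:~R.
    have ux : (x%:~R : 'Z_N) \is a GRing.unit by apply/unitrP; exists x%:~R.
    by apply: (mulrI ux); rewrite mulrV // xx.
  have /pm1P[->|->] := @pm1_exprz (-1) isT i; first by rewrite expr1z.
  exact: hu.
pose Qh := periodic n x Q.
have Qhp i : combine e f (Qh i) = p i.
  have [q [r [hr ->]]] := int_divn_eq i n_gt0.
  rewrite /Qh (periodicE n_gt0 x1 Qn q (ltnW hr)) combine_scale PQ 1?ltnW //.
  elim/int_shift_ind: q => [|q|q].
  - by rewrite expr0z /Defs.scale_pair !mul1r mul0r add0r; case: (p _).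
  - rewrite (_ : (q + 1) * n%:Z + r%:Z = q * n%:Z + r%:Z + n%:Z); last by lia.
    rewrite pn => <-; rewrite (exprzS x1) /Defs.scale_pair /=.
    by rewrite [_ * x]mulrC rmorphM /= !mulrA.
  - rewrite (_ : (q + 1) * n%:Z + r%:Z = q * n%:Z + r%:Z + n%:Z); last by lia.
    rewrite pn (exprzS x1) => h; set y := p (q * n%:Z + r%:Z) in h *.
    rewrite -[RHS](_ : Defs.scale_pair x%:~R (Defs.scale_pair x%:~R y) = _).
      rewrite -h /Defs.scale_pair /=.
      by rewrite [_ * x]mulrC rmorphM /= !mulrA xx !mul1r.
    by rewrite /Defs.scale_pair /= !mulrA xx !mul1r; case: (y).
have [frF tF] := cross_frieze (periodic_cross n_gt0 x1 Qn QQ)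
                              (periodic_shift n_gt0 x1 Qn).
exists (fun i j => cross (Qh j) (Qh i)); split=> // i j ij.
by rewrite Fp // -(cross_combine ef) !Qhp.
Qed.

End Sufficiency.

(** * Existence of a path corresponding to a tame semiregular frieze *)

Section Recurrence.
Variable R : comPzRingType.

Fixpoint recurrence (a : int -> R) (x y : R) (k : nat) : R * R :=
  if k is l.+1 then
    let u := recurrence a x y l in (u.2, a k%:Z * u.2 - u.1)
  else (x, y).

(** The solution of the recurrence of [two_sidedE] with values [x] and [y] at
    [0] and [1]. The negative half is the forward solution for the sequence
    reflected by [j |-> 1 - j], which exchanges the two initial values. *)
Definition two_sided (a : int -> R) (x y : R) (i : int) : R :=
  match i with
  | Posz k => (recurrence a x y k).1
  | Negz k => (recurrence (fun j => a (1 - j)) y x k.+2).1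
  end.

Lemma two_sidedE a x y i :
  two_sided a x y (i + 1) = a i * two_sided a x y i - two_sided a x y (i - 1).
Proof.
case: i => [[|k]|k].
- by rewrite /= subrr; ring.
- have -> : k.+1%:Z + 1 = k.+2%:Z by lia.
  by have -> : k.+1%:Z - 1 = k%:Z by lia.
- have -> : Negz k - 1 = Negz k.+1 by lia.
  have -> : two_sided a x y (Negz k + 1) =
            (recurrence (fun j => a (1 - j)) y x k.+1).1.
    case: k => [|k] //.
    by have -> : Negz k.+1 + 1 = Negz k by lia.
  have aE : a (Negz k) = a (1 - k.+2%:Z) by congr a; lia.
  rewrite aE /=; ring.
Qed.

End Recurrence.

Section Tame.
Variables (R : comPzRingType) (n : nat) (F : int -> int -> R).
Hypotheses (frF : frieze n F) (tF : tame n F) (rF : semiregular F).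

(** Starting at the diagonal and moving away from it, each vanishing
    determinant propagates the relation between three consecutive rows from
    two columns to the next; semiregularity and the frieze rule give the
    first two columns. *)
Lemma frieze_row_recurrence (i : int) (k : nat) : (k.+1 < n)%N ->
  F (i + 1) (i - 1 - k%:Z) + F (i - 1) (i - 1 - k%:Z) =
  F (i + 1) (i - 1) * F i (i - 1 - k%:Z).
Proof.
have [F0 _ F2] := frF.
have F1 j : F j (j - 1) = 1 by rewrite -[RHS](rF (j - 1)) subrK.
suff: ((k.+1 < n)%N -> F (i + 1) (i - 1 - k%:Z) + F (i - 1) (i - 1 - k%:Z) =
        F (i + 1) (i - 1) * F i (i - 1 - k%:Z)) /\
      ((k.+2 < n)%N -> F (i + 1) (i - 1 - k.+1%:Z) + F (i - 1) (i - 1 - k.+1%:Z) =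
        F (i + 1) (i - 1) * F i (i - 1 - k.+1%:Z)) by case.
elim: k => [|k [IH0 IH1]]; split.
- by move=> _; rewrite subr0 F0 F1; ring.
- move=> hn; rewrite F1 -[X in _ + X](F2 i (i - 1 - 1)); last by lia.
  by rewrite !subrK F1; ring.
- exact: IH1.
move=> hn; set j := i - 1 - k.+2%:Z.
have hk : i - 1 - k%:Z = j + 2%:Z by lia.
have hk1 : i - 1 - k.+1%:Z = j + 1 by lia.
have {IH0} h2 := IH0 (ltnW (ltnW hn)).
have {IH1} h1 := IH1 (ltnW hn).
rewrite hk in h2; rewrite hk1 in h1.
have hj2 : j + 1 + 1 = j + 2%:Z by lia.
have hm : F (i - 1) (j + 1) * F i (j + 2%:Z)
          - F (i - 1) (j + 2%:Z) * F i (j + 1) = 1.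
  by rewrite -hj2 -[RHS](F2 (i - 1) (j + 1)) ?subrK //; lia.
pose G (r c : nat) := F (i - 1 + r%:Z) (j + 1 - 1 + c%:Z).
have GE a b r c : i - 1 + r%:Z = a -> j + 1 - 1 + c%:Z = b -> G r c = F a b.
  by move=> <- <-.
have r0 : i - 1 + 0%N%:Z = i - 1 by lia.
have r1 : i - 1 + 1%N%:Z = i by lia.
have r2 : i - 1 + 2%N%:Z = i + 1 by lia.
have c0 : j + 1 - 1 + 0%N%:Z = j by lia.
have c1 : j + 1 - 1 + 1%N%:Z = j + 1 by lia.
have c2 : j + 1 - 1 + 2%N%:Z = j + 2%:Z by lia.
have hd : \det (\matrix_(r < 3, c < 3) G r c) = 0 by apply: tF; lia.
rewrite (det3 G) in hd.
rewrite (GE _ _ _ _ r0 c0) (GE _ _ _ _ r0 c1) (GE _ _ _ _ r0 c2) in hd.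
rewrite (GE _ _ _ _ r1 c0) (GE _ _ _ _ r1 c1) (GE _ _ _ _ r1 c2) in hd.
rewrite (GE _ _ _ _ r2 c0) (GE _ _ _ _ r2 c1) (GE _ _ _ _ r2 c2) in hd.
exact: (det_extrapolate h1 h2 hm hd).
Qed.

(** Both sides are solutions in [i] of the recurrence of
    [frieze_row_recurrence], with equal values at [i = j] and [i = j + 1]. *)
Lemma tame_frieze_cross : exists p : int -> R * R,
  (forall i, cross (p i) (p (i + 1)) = 1) /\
  forall i j, in_strip n i j -> F i j = cross (p j) (p i).
Proof.
have [F0 _ _] := frF.
pose a i := F (i + 1) (i - 1).
pose p i := (two_sided a 1 0 i, two_sided a 0 1 i).
have pS i : p (i + 1) =
    (a i * (p i).1 - (p (i - 1)).1, a i * (p i).2 - (p (i - 1)).2).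
  by rewrite /p !two_sidedE.
have pp i : cross (p i) (p (i + 1)) = 1.
  have E j : cross (p j) (p (j + 1)) = cross (p (j - 1)) (p j).
    by rewrite pS /cross /=; ring.
  elim/int_shift_ind: i => [|i IH|i].
  - by rewrite /cross /= mulr1 mulr0 subr0.
  - by rewrite E addrK.
  - by rewrite E addrK.
exists p; split=> // i j ij.
have [k [-> hk]] : exists k : nat, i = j + k%:Z /\ (k <= n)%N.
  by exists `|i - j|%N; move: ij; rewrite /in_strip; lia.
suff: F (j + k%:Z) j = cross (p j) (p (j + k%:Z)) /\
      ((k < n)%N -> F (j + k.+1%:Z) j = cross (p j) (p (j + k.+1%:Z))) by case.
elim: k hk {ij} => [|k IH] hk.
  split; last by move=> _; rewrite pp rF.
  by rewrite addr0 F0 /cross; ring.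
have [IH0 IH1] := IH (ltnW hk); split=> [|hk2]; first exact: IH1.
have hr := frieze_row_recurrence (j + k.+1%:Z) hk2.
rewrite (_ : _ - 1 - k%:Z = j) in hr; last by lia.
rewrite (_ : j + k.+2%:Z = j + k.+1%:Z + 1); last by lia.
rewrite pS /a.
rewrite (_ : j + k.+1%:Z - 1 = j + k%:Z) in hr *; last by lia.
transitivity (F (j + k.+1%:Z + 1) (j + k%:Z) * F (j + k.+1%:Z) j - F (j + k%:Z) j).
  by rewrite -hr; ring.
by rewrite (IH1 hk) IH0 /cross /=; ring.
Qed.

End Tame.

Section CorrespondingPath.
Variables (N n : nat) (F : int -> int -> 'Z_N).
Hypotheses (n_gt0 : (0 < n)%N).
Hypotheses (frF : frieze n F) (tF : tame n F) (rF : semiregular F).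

(** [p (i + n)] is proportional to [p i] by a factor whose product with the
    next such factor is [1], because consecutive determinants are [1] at [i]
    and at [i + n]; so the factors alternate between [lam] and its inverse. *)
Lemma cross_periodic (p : int -> 'Z_N * 'Z_N) :
    (forall i, cross (p i) (p (i + 1)) = 1) ->
    (forall i, cross (p i) (p (i + n%:Z)) = 0) ->
  exists2 lam : 'Z_N, lam \is a GRing.unit & forall i : int,
    p (i + n%:Z) = Defs.scale_pair (lam ^ ((-1 : int) ^ i)) (p i).
Proof.
move=> pp p0; pose L i := cross (p (i + n%:Z)) (p (i + 1)).
have pL i : p (i + n%:Z) = Defs.scale_pair (L i) (p i).
  by rewrite [LHS](cross_frame _ (pp i)) p0 /Defs.scale_pair !mul0r !addr0.
have LL i : L i * L (i + 1) = 1.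
  rewrite -(pp (i + n%:Z)) addrAC !pL cross_scale.
  by rewrite pp mulr1.
have uL i : L i \is a GRing.unit.
  by apply/unitrP; exists (L (i + 1)); rewrite mulrC LL.
have LV i : L (i + 1) = (L i)^-1.
  by apply: (mulrI (uL i)); rewrite LL divrr.
exists (L 0) => // i; rewrite pL; congr Defs.scale_pair.
have sS j : (-1 : int) ^ (j + 1) = - (-1) ^ j.
  by rewrite exprzDr // expr1z mulrN1.
elim/int_shift_ind: i => [|i IH|i]; first by rewrite expr0z expr1z.
  by rewrite LV IH sS invr_expz.
by rewrite LV sS -invr_expz => /invr_inj.
Qed.

(** A condition on all paths corresponding to [F] can yield a lift only
    because there is at least one such path. *)
Lemma corresponding_path_exists :
  exists v0 (s : seq (farey_vertex N)), corresponds n v0 s F.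
Proof.
have [p [pp Fp]] := tame_frieze_cross frF tF rF.
have [_ Fn _] := frF.
have p0 i : cross (p i) (p (i + n%:Z)) = 0.
  by rewrite -Fp ?(addrC i) ?Fn // /in_strip; lia.
have [lam ulam pn] := cross_periodic pp p0.
have up i : unimodular (p i) by apply: unimodular_cross (pp i).
have vP i : is_farey_vertex (pm_class (p i)).
  by apply/existsP; exists (p i); rewrite up eqxx.
pose v (i : nat) : farey_vertex N := exist _ (pm_class (p i%:Z)) (vP i%:Z).
have pv i : p i%:Z \in val (v i) by exact: pm_class_id.
pose s := [seq v i | i <- iota 1 n].
have sv i : (i <= n)%N -> nth (v 0%N) (v 0%N :: s) i = v i.
  move=> hi; have -> : v 0%N :: s = map v (iota 0 n.+1) by [].
  by rewrite (nth_map 0%N) ?size_iota // nth_iota.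
have adj i : cross (p i%:Z) (p i.+1%:Z) = 1.
  by rewrite -(pp i); congr cross; congr p; lia.
have ss : size s = n by rewrite size_map size_iota.
exists (v 0%N), s; split=> //.
- apply/(pathP (v 0%N)) => i; rewrite ss => hi.
  rewrite (sv i (ltnW hi)) (sv i.+1 hi : nth _ s i = _).
  rewrite (farey_adjE (pv i) (pv i.+1)) adj.
  by rewrite /pm1 eqxx.
- exists lam => //; rewrite (last_nth (v 0%N)) ss sv //=.
  have := pn 0; rewrite add0r expr0z expr1z => ->.
  rewrite /pm_class imsetU1 imset_set1; congr [set _; _].
  by rewrite /Defs.scale_pair /=; congr pair; ring.
- exists p => //; split; last by exists lam.
    by move=> i hi; rewrite sv.
  by move=> i hi; rewrite /E_edge !up -[det2 _ _]/(cross _ _) adj eqxx.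
Qed.

End CorrespondingPath.

Theorem theorem1p6 (N n : nat) (hN : (2 <= N)%N) (hn : (2 <= n)%N)
    (F : int -> int -> 'Z_N) (hF : frieze n F) (tameF : tame n F)
    (regF : semiregular F) :
  (exists Ft : int -> int -> int,
     [/\ frieze n Ft, tame n Ft & lift_of n F Ft])
  <->
  (forall (v0 : farey_vertex N) (s : seq (farey_vertex N)),
     corresponds n v0 s F ->
     closed_path v0 s /\ strongly_contractible (v0 :: s)).
Proof.
split=> [[Ft [frFt _ liftFt]] v0 s|contr].
  exact: (frieze_lift_contractible hn liftFt frFt).
have n_gt0 : (0 < n)%N by apply: ltnW.
have [v0 [s hs]] := corresponding_path_exists n_gt0 hF tameF regF.
by apply: (contractible_frieze_lifts n_gt0 hs); case: (contr _ _ hs).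
Qed.
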